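(* Let $X$ be a connected finite polyhedron, $n\ge1$, and let $f=\{f_1,\dots,f_n\}\colon X\to D_n(X)$ be a split $n$-valued map. Then $$R(f)=R(f_1)+\cdots+R(f_n),$$ where on the right side $R$ denotes the classical Reidemeister number of a single-valued map.
   Context: Let $p\colon\tilde X\to X$ be the universal covering space; $\pi_1(X)$ is identified with the group of covering transformations of $p$. $D_n(X)$ is the set of $n$-element subsets of $X$, topologized as the quotient by the symmetric group $\Sigma_n$ of $F_n(X)=\{(x_1,\dots,x_n)\in X^n\mid x_i\ne x_j\text{ for }i\neq j\}$. An $n$-valued map is a continuous map $f\colon X\to D_n(X)$. It is split if there are continuous single-valued maps $f_1,\dots,f_n\colon X\to X$ with $f(x)=\{f_1(x),\dots,f_n(x)\}$ for all $x\in X$. Let $F_n(\tilde X,\pi)=\{(\tilde x_1,\dots,\tilde x_n)\in\tilde X^n\mid \tilde x_i\ne\alpha\tilde x_j \text{ for all } i\neq j,\ \alpha\in\pi_1(X)\}$ and $p^n(\tilde x_1,\dots,\tilde x_n)=\{p(\tilde x_1),\dots,p(\tilde x_n)\}$. A lifting of an $n$-valued map $f$ is a continuous map $\bar f=(\bar f_1,\dots,\bar f_n)\colon\tilde X\to F_n(\tilde X,\pi)$ with $p^n\circ\bar f=f\circ p$; the coordinate maps of all liftings of $f$ are the lift-factors of $f$. Two lift-factors are equivalent if $\bar f_i=\gamma\bar f'_j\gamma^{-1}$ for some $\gamma\in\pi_1(X)$; $R(f)$ is the number (possibly $\infty$) of equivalence classes of lift-factors. For a single-valued map $g\colon X\to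 X$, the classical Reidemeister number $R(g)$ is the number of equivalence classes of liftings $\tilde g\colon\tilde X\to\tilde X$ of $g$ under conjugation $\tilde g\mapsto\gamma\tilde g\gamma^{-1}$ by $\gamma\in\pi_1(X)$. *)

(* Defs.v *)
From HB Require Import structures.
From mathcomp Require Import all_boot all_order all_algebra.
From mathcomp Require Import all_fingroup.
From mathcomp Require Import all_classical all_reals all_analysis.

Set Implicit Arguments.
Unset Strict Implicit.
Unset Printing Implicit Defensive.

Import Order.TTheory GRing.Theory Num.Theory.
Import numFieldNormedType.Exports.

Local Open Scope classical_set_scope.
Local Open Scope ring_scope.

Definition homeomorphism (S T : topologicalType) (h : S -> T) : Prop :=
  continuous h /\
  exists g : T -> S, [/\ continuous g, cancel h g & cancel g h].

(* The empty simplex is excluded; elements of V need not be vertices of K. *)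
Definition simplicial_complex (V : finType) (K : {set {set V}}) : Prop :=
  finset.set0 \notin K /\
  forall s t : {set V}, s \in K -> t \subset s -> t != finset.set0 -> t \in K.

(* Barycentric coordinates: |K| is the union of the simplices of K inside the
   standard simplex of R^V. *)
Definition realization (R : realType) (V : finType) (K : {set {set V}}) :
    set {ptws V -> R} :=
  [set x | [/\ forall v, 0 <= x v, \sum_v x v = 1 &
               [set v | x v != 0]%SET \in K]].

Definition finite_polyhedron (R : realType) (X : topologicalType) : Prop :=
  exists (V : finType) (K : {set {set V}}), simplicial_complex K /\
  exists h : X -> set_type (@realization R V K), homeomorphism h.

Definition path_connected (R : realType) (T : topologicalType) : Prop :=
  forall x y : T, exists c : R -> T,
    [/\ {within `[0, 1], continuous c}, c 0 = x & c 1 = y].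

Definition simply_connected (R : realType) (T : topologicalType) : Prop :=
  [/\ inhabited T, path_connected R T &
      forall (x : T) (c : R -> T),
        {within `[0, 1], continuous c} -> c 0 = x -> c 1 = x ->
        exists H : R * R -> T,
          [/\ {within `[0, 1] `*` `[0, 1], continuous H},
              forall t : R, t \in `[0, 1] -> H (0, t) = c t,
              forall t : R, t \in `[0, 1] -> H (1, t) = x &
              forall s : R, s \in `[0, 1] -> H (s, 0) = x /\ H (s, 1) = x]].

Definition covering_map (E X : topologicalType) (p : E -> X) : Prop :=
  [/\ continuous p, range p = setT &
      forall x : X, exists U : set X, [/\ open U, U x &
        exists sheets : set (set E),
          [/\ forall V, sheets V -> open V,
              trivIset sheets id,
              p @^-1` U = \bigcup_(V in sheets) V &
              forall V, sheets V -> exists h : set_type V -> set_type U,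
                homeomorphism h /\ forall z, \val (h z) = p (\val z)]]].

Definition universal_covering (R : realType) (E X : topologicalType)
    (p : E -> X) : Prop :=
  covering_map p /\ simply_connected R E.

Definition covering_transformation (E X : topologicalType) (p : E -> X)
    (a : E -> E) : Prop :=
  homeomorphism a /\ p \o a = p.

Definition Fn (n : nat) (X : topologicalType) : set {ptws 'I_n -> X} :=
  [set x | forall i j, i != j -> x i <> x j].

Definition DnT (n : nat) (X : Type) : Type :=
  set_type [set A : set X | (A #= `I_n)%card].

Lemma Fn_card n (X : topologicalType) (x : set_type (@Fn n X)) :
  range (\val x : 'I_n -> X) \in [set A : set X | (A #= `I_n)%card].
Proof.
apply/mem_set => /=; case: x => x /= /set_mem xF.
have xI : injective (x : 'I_n -> X).
  by move=> i j xij; apply/eqP/negPn/negP => /xF.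
apply: (card_eq_trans (inj_card_eq _)); first by move=> i j _ _; exact: xI.
by rewrite card_eq_sym; exact: card_II.
Qed.

Definition Dn_pi n (X : topologicalType) (x : set_type (@Fn n X)) : DnT n X :=
  exist _ (range (\val x : 'I_n -> X)) (Fn_card x).

Lemma Dn_pi_surj n (X : topologicalType) (A : DnT n X) :
  exists x : set_type (@Fn n X), Dn_pi x = A.
Proof.
case: A => A pA; have := set_mem pA => /= An.
have := card_esym An; rewrite (card_eql card_II) => /card_eqVP[f].
pose g : {ptws 'I_n -> X} := fun i => \val (f (to_setT i)).
have gF : g \in @Fn n X.
  apply/mem_set => i j /eqP ij gij; apply: ij.
  have /val_inj/(@inj _ _ _ f) := gij.
  by move=> /(_ (mem_set I) (mem_set I)) /(congr1 \val).
exists (exist _ g gF); apply: val_inj => /=.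
apply/seteqP; split => [_ [i _ <-]|a Aa]; first exact: set_valP.
have [u _ fu] := @surj _ _ _ _ f (exist _ a (mem_set Aa)) I.
exists (\val u) => //; rewrite /g.
have -> : to_setT (\val u) = u by apply: val_inj.
by rewrite fu.
Qed.

(* The fibres of [Dn_pi] are the orbits of the symmetric group. *)
Lemma Dn_pi_orbit n (X : topologicalType) (x y : set_type (@Fn n X)) :
  Dn_pi x = Dn_pi y <->
  exists s : 'S_n, forall i, (\val x : 'I_n -> X) i = \val y (s i).
Proof.
split=> [/(congr1 \val)/= xy|[s xy]]; last first.
  apply: val_inj => /=; apply/seteqP; split => _ [i _ <-].
    by exists (s i) => //; rewrite xy.
  by exists ((s^-1)%g i) => //; rewrite xy permKV.
have /choice[s sE] : forall i, exists j, (\val x : 'I_n -> X) i = \val y j.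
  move=> i; have : range (\val y : 'I_n -> X) ((\val x : 'I_n -> X) i).
    by rewrite -xy; exists i.
  by case=> j _ <-; exists j.
have sI : injective s.
  move=> i j sij; apply/eqP/negPn/negP; have xF := set_mem (valP x).
  by move=> /xF; apply; rewrite !sE sij.
by exists (perm sI) => i; rewrite permE; exact: sE.
Qed.

HB.instance Definition _ n (X : topologicalType) :=
  @isQuotient.Build (set_type (@Fn n X)) (DnT n X)
    (fun A => sval (cid (Dn_pi_surj A))) (@Dn_pi n X)
    (fun A => svalP (cid (Dn_pi_surj A))).

Definition Dn (n : nat) (X : topologicalType) : topologicalType :=
  quotient_topology (DnT n X : quotType (set_type (@Fn n X))).

Lemma Dn_openE n (X : topologicalType) (U : set (Dn n X)) :
  open U = open ((@Dn_pi n X : _ -> Dn n X) @^-1` U).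
Proof. by rewrite {1}/open /= /quotient_open generic_quotient.pi.unlock. Qed.

Definition points n (X : topologicalType) (A : Dn n X) : set X :=
  \val (A : DnT n X).

Definition splitting n (X : topologicalType) (f : X -> Dn n X)
    (fs : 'I_n -> X -> X) : Prop :=
  (forall i, continuous (fs i)) /\
  forall x, points (f x) = [set fs i x | i in setT].

Section Reidemeister.
Context {E X : topologicalType} (p : E -> X).

Definition Fn_deck (n : nat) : set {ptws 'I_n -> E} :=
  [set z | forall i j a, i != j -> covering_transformation p a ->
             z i <> a (z j)].

(* The equation p^n \o fbar = f \o p is stated on the underlying subsets of X:
   that p^n takes values in n-element sets is a theorem about p. *)
Definition lifting n (f : X -> Dn n X) (fbar : E -> set_type (@Fn_deck n)) :
    Prop :=
  continuous fbar /\
  forall z, [set p (\val (fbar z) i) | i in [set: 'I_n]] = points (f (p z)).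

Definition lift_factor n (f : X -> Dn n X) : set (E -> E) :=
  [set h | exists (fbar : E -> set_type (@Fn_deck n)) (i : 'I_n),
     lifting f fbar /\ forall z, h z = \val (fbar z) i].

Definition deck_conjugate (h h' : E -> E) : Prop :=
  exists a b : E -> E, [/\ covering_transformation p a,
    cancel a b, cancel b a & h = a \o h' \o b].

Definition conjugacy_classes (S : set (E -> E)) : set (set (E -> E)) :=
  [set [set h' | S h' /\ deck_conjugate h h'] | h in S].

Definition reidemeister_nvalued (R : realType) n (f : X -> Dn n X) : \bar R :=
  counting (conjugacy_classes (lift_factor f)).

Definition reidemeister (R : realType) (g : X -> X) : \bar R :=
  counting (conjugacy_classes
    [set h : E -> E | continuous h /\ p \o h = g \o p]).

End Reidemeister.

(* Main.v *)
Require Import Defs.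
From HB Require Import structures.
From mathcomp Require Import all_boot all_order all_algebra.
From mathcomp Require Import all_fingroup.
From mathcomp Require Import all_classical all_reals all_analysis.
From mathcomp Require Import lra.
Import Order.TTheory GRing.Theory Num.Theory.
Import numFieldNormedType.Exports.
Local Open Scope classical_set_scope.
Local Open Scope ring_scope.

(** A coordinate [h] of a lifting of [f] satisfies
    [p (h z) \in {f_1 (p z), ..., f_n (p z)}] for every [z].  The [n] sets
    where [p \o h] agrees with a given [f_i \o p] are closed because a
    polyhedron is Hausdorff, they are disjoint because the values [f_i x] are
    pairwise distinct, and they cover the connected space [E]; so one of them is
    all of [E], and [h] is a lift of a single [f_i] ([lift_factor_lifts]).
    Conversely a lift of [f_i] extends to a lifting of [f] as soon as the other
    [f_j] have lifts at all, the coordinates being automatically in distinct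
    orbits ([lifts_lift_factor]).  Hence the lift-factors of [f] are the
    disjoint union of the sets of lifts of the [f_i].  If [a] is a deck
    transformation, conjugation by [a] does not change the map of [X] that is
    lifted, so every class lies in one of these sets, and counting classes is
    additive ([conjugacy_classes_bigcup], [counting_bigcup]).

    The substance is the existence of lifts, that is the lifting criterion for
    maps [g] from a simply connected, locally path connected space [S]
    ([lifting_criterion]).  It is obtained from path connectedness in the fibre
    product [P] of pairs [(z, e)] with [p e = g z]: the pairs that a path in [P]
    joins to [(z0, e0)] form the graph of the lift.  Path lifting makes it
    total; it is functional because a null-homotopic loop lifts to a closed path
    ([nullhomotopic_lift_closed]); local path connectedness makes the lift agree
    near each point with a local section of [p] composed with [g], hence
    continuous.  Both lifting properties come from one statement, that every map
    of a rectangle to [X] lifts ([liftable_box]), whose proof replaces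
    subdivision grids and Lebesgue numbers by two uses of Cousin's lemma:
    rectangles with liftable maps can be pasted along a common edge
    ([liftableU]), and small ones are liftable.

    Finally, a polyhedron is locally path connected because the segment from [x]
    to a point whose support contains that of [x] stays in a simplex
    ([realization_locally_path_connected]), and this property passes up to the
    covering space. *)

(** * Sheets of a covering and uniqueness of lifts *)

(** The homeomorphism from a sheet [V] onto [U] is recorded through its inverse
    [s], as a function on all of [X] whose values outside [U] are junk: this
    keeps subtypes out of all that follows. *)
Definition sheet {E X : topologicalType} (p : E -> X) (U : set X) (V : set E)
    (s : X -> E) : Prop :=
  [/\ open U, open V, {in U, continuous s},
      forall x, U x -> V (s x) /\ p (s x) = x &
      forall e, V e -> U (p e) /\ s (p e) = e].

Lemma covering_sheet {E X : topologicalType} (p : E -> X) :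
  covering_map p -> forall x, exists U : set X,
    [/\ open U, U x & forall e, U (p e) ->
      exists V s, V e /\ sheet p U V s].
Proof.
move=> [cp _ covp] x; have [U [oU Ux [sheets [oS _ pU hS]]]] := covp x.
exists U; split=> // e Upe.
have [V SV Ve] : (\bigcup_(V in sheets) V) e by rewrite -pU.
have [h [[ch [k [ck hk kh]]] hp]] := hS _ SV.
have sU y (Uy : U y) :
    valL_ e (\val \o k : U -> E) y = \val (k (exist _ y (mem_set Uy))).
  exact: (congr1 (@^~ (exist _ y (mem_set Uy)))
    (valLK e (\val \o k : U -> E))).
exists V, (valL_ e (\val \o k : U -> E)); split=> //; split=> //.
- exact: oS.
- rewrite -continuous_open_subspace//.
  apply/subspace_valL_continuousP' => y.
  by apply: continuous_comp; [exact: ck|exact: initial_continuous].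
- move=> y Uy; rewrite sU; split; first exact: set_valP.
  by rewrite -hp kh.
- move=> e' Ve'; have Upe' : U (p e').
    by rewrite -[U _]/((p @^-1` U) e') pU; exists V.
  split=> //; rewrite sU.
  have -> : exist _ (p e') (mem_set Upe') = h (exist _ e' (mem_set Ve')).
    by apply: val_inj; rewrite hp.
  by rewrite hk.
Qed.

(** Over one point of [X], distinct points lie in distinct sheets, which are
    disjoint. *)
Lemma covering_fiber_separated {E X : topologicalType} (p : E -> X) e e' :
  covering_map p -> p e = p e' -> e <> e' ->
  exists V V' : set E,
    [/\ nbhs e V, nbhs e' V' & forall z, V z -> V' z -> False].
Proof.
move=> [cp _ covp] pe ee'; have [U [oU Ux [sheets [oS tS pU hS]]]] := covp (p e).
have [V SV Ve] : (\bigcup_(V in sheets) V) e by rewrite -pU.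
have [V' SV' Ve'] : (\bigcup_(V in sheets) V) e' by rewrite -pU /= -pe.
exists V, V'; split; [exact: open_nbhs_nbhs (conj (oS _ SV) Ve)|
  exact: open_nbhs_nbhs (conj (oS _ SV') Ve')|] => z Vz V'z.
have VV' : V = V' by apply: tS => //; exists z.
case: ee'; rewrite -VV' in Ve'; have [h [[_ [k [_ hk _]]] hp]] := hS _ SV.
have : h (exist _ e (mem_set Ve)) = h (exist _ e' (mem_set Ve')).
  by apply: val_inj; rewrite !hp.
by move=> /(can_inj hk) [].
Qed.

Lemma within_nbhs {S T : topologicalType} (D : set S) (L : S -> T) x V :
  {within D, continuous L} -> nbhs (L x) V ->
  \forall y \near (x : subspace D), V (L y).
Proof. by move=> cL /(cL x). Qed.

(** The set where two lifts agree is open since [p] is injective on a sheet, and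
    closed by [covering_fiber_separated]. *)
Lemma lift_unique {E X S : topologicalType} (p : E -> X) (D : set S)
    (L1 L2 : S -> E) (z : S) :
  covering_map p -> connected D ->
  {within D, continuous L1} -> {within D, continuous L2} ->
  (forall x, D x -> p (L1 x) = p (L2 x)) -> D z -> L1 z = L2 z ->
  forall x, D x -> L1 x = L2 x.
Proof.
move=> covp /clopen_connectedP cD c1 c2 p12 Dz L12z x Dx.
pose U := D `&` [set y | L1 y = L2 y].
suff UD : U = D by have [] : U x by rewrite UD.
apply: cD; [split|exact: subIsetl|by exists z].
- rewrite openE => y [Dy L12y]; rewrite /interior/=.
  have [W [oW Wy]] := covering_sheet _ covp (p (L1 y)).
  move=> /(_ _ Wy) [V [s [Ve [_ oV _ _ Vs]]]].
  have nV : nbhs (L1 y) V by exact: open_nbhs_nbhs.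
  have n1 := within_nbhs _ _ _ _ c1 nV.
  rewrite L12y in nV; have n2 := within_nbhs _ _ _ _ c2 nV.
  have nD : \forall t \near (y : subspace D), D t.
    apply: (@open_nbhs_nbhs (subspace D) y D).
    by split; first exact: open_subspaceT.
  near=> t; have Dt : D t by near: t.
  split=> //=.
  have [_ <-] : W (p (L1 t)) /\ s (p (L1 t)) = L1 t by apply: Vs; near: t.
  have [_ <-] : W (p (L2 t)) /\ s (p (L2 t)) = L2 t by apply: Vs; near: t.
  by rewrite p12.
- rewrite -[U]setCK; apply: open_closedC; rewrite openE => y Uy.
  rewrite /interior/=; have [Dy|nDy] := pselect (D y); last first.
    have : nbhs (y : subspace D) [set y].
      by apply: open_nbhs_nbhs; split=> //; exact: open_subspace1out.
    by apply: filterS => t ->.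
  have L12y : L1 y <> L2 y by move=> L12; apply: Uy.
  have [V [V' [nV nV' VV']]] := covering_fiber_separated _ _ _ covp (p12 _ Dy) L12y.
  have n1 := within_nbhs _ _ _ _ c1 nV; have n2 := within_nbhs _ _ _ _ c2 nV'.
  near=> t; move=> [_ /= L12t]; apply: (VV' (L1 t)); first by near: t.
  by rewrite L12t; near: t.
Unshelve. all: by end_near. Qed.

(** * Lifting maps of rectangles *)

(** Quantifying over the prescribed value [e] at an arbitrary point [z] of [D],
    rather than asking for one lift, is what makes the property stable under
    pasting. *)
Definition liftable {E X S : topologicalType} (p : E -> X) (F : S -> X)
    (D : set S) : Prop :=
  forall z e, D z -> p e = F z -> exists L : S -> E,
    [/\ {within D, continuous L}, L z = e & forall x, D x -> p (L x) = F x].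

Lemma liftable_in_covered {E X S : topologicalType} (p : E -> X) (F : S -> X)
    (D : set S) (U : set X) :
  (forall e, U (p e) -> exists V s, V e /\ sheet p U V s) ->
  {within D, continuous F} -> (forall x, D x -> U (F x)) -> liftable p F D.
Proof.
move=> covU cF DU z e Dz pe; have := DU _ Dz; rewrite -pe.
move=> /covU [V [s [Ve [oU oV cs Us Vs]]]].
(* The sheet is the one through the prescribed value [e]. *)
exists (s \o F); split.
- apply: within_continuous_comp => // y /set_mem [t Dt <-].
  by apply: cs; apply/mem_set/DU.
- by rewrite /= -pe; have [] := Vs _ Ve.
- by move=> x /DU /Us [].
Qed.

(** A lift on one piece determines the value required at a point of the
    intersection; by uniqueness on the connected intersection the two lifts then
    agree there, and they paste. *)
Lemma liftableU {E X S : topologicalType} (p : E -> X) (F : S -> X)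
    (A B : set S) :
  covering_map p -> closed A -> closed B -> connected (A `&` B) ->
  A `&` B !=set0 -> liftable p F A -> liftable p F B -> liftable p F (A `|` B).
Proof.
move=> covp clA clB cAB [w [Aw Bw]] lA lB z e ABz pe.
wlog Az : A B clA clB cAB Aw Bw lA lB ABz / A z => [wl|].
  case: ABz => [Az|Bz]; first by apply: wl => //; left.
  by rewrite setUC; apply: wl; rewrite 1?setIC//; left.
have [L [cL Lz pL]] := lA _ _ Az pe.
have [M [cM Mw pM]] := lB _ _ Bw (pL _ Aw).
have LM x : A x -> B x -> L x = M x.
  move=> Ax Bx; apply: (lift_unique p _ L M w covp cAB) => //.
  - exact: continuous_subspaceW cL.
  - exact: continuous_subspaceW cM.
  - by move=> y [Ay By]; rewrite pL // pM.
pose N x := if x \in A then L x else M x.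
have NL : {in A, L =1 N} by move=> x Ax; rewrite /N Ax.
have NM : {in B, M =1 N}.
  by move=> x /set_mem Bx; rewrite /N; case: ifPn => // /set_mem Ax; rewrite LM.
exists N; split.
- apply: withinU_continuous => //.
  + exact: subspace_eq_continuous NL cL.
  + exact: subspace_eq_continuous NM cM.
- by rewrite -NL//; exact: mem_set.
- by move=> x [Ax|Bx]; [rewrite -NL ?inE ?pL|rewrite -NM ?inE ?pM].
Qed.

Lemma pair_continuous {T U V : topologicalType} (f : T -> U) (g : T -> V) :
  continuous f -> continuous g -> continuous (fun t => (f t, g t)).
Proof. by move=> cf cg t; exact: cvg_pair (cf t) (cg t). Qed.

Lemma id_continuous {T : topologicalType} : continuous (fun t : T => t).
Proof. by move=> t; exact: cvg_id. Qed.

Lemma setXUr {T U : Type} (A : set T) (B C : set U) :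
  A `*` (B `|` C) = (A `*` B) `|` (A `*` C).
Proof.
apply/seteqP; split=> -[x y] /=.
  by move=> [Ax [By|Cy]]; [left|right].
by move=> [[Ax By]|[Ax Cy]]; split=> //; [left|right].
Qed.

Lemma setXUl {T U : Type} (A B : set T) (C : set U) :
  (A `|` B) `*` C = (A `*` C) `|` (B `*` C).
Proof.
apply/seteqP; split=> -[x y] /=.
  by move=> [[Ax|Bx] Cy]; [left|right].
by move=> [[Ax Cy]|[Bx Cy]]; split=> //; [left|right].
Qed.

(** Cousin's lemma: the supremum of the [t] such that [Q a t] cannot be less
    than [b], by locality at the supremum. *)
Lemma cousin {R : realType} (Q : R -> R -> Prop) :
  (forall a b c, a <= b -> b <= c -> Q a b -> Q b c -> Q a c) ->
  (forall x, exists2 e, 0 < e &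
    forall a b, x - e < a -> a <= x -> x <= b -> b < x + e -> Q a b) ->
  forall a b, a <= b -> Q a b.
Proof.
move=> Qadd Qloc a b ab; pose S := [set t | a <= t <= b /\ Q a t].
have Sa : S a.
  split; first by rewrite lexx.
  by have [e e0] := Qloc a; apply=> //; lra.
have ubS : has_ubound S by exists b => t [/andP[]].
have sb : sup S <= b by apply: ge_sup; [exists a|move=> t [/andP[]]].
have [e e0 Qe] := Qloc (sup S).
have [t [/andP[at_ tb] Qat] st] := sup_adherent e0 (conj (ex_intro _ a Sa) ubS).
have ts : t <= sup S by apply: ub_le_sup => //; split=> //; apply/andP.
have Qs u : sup S <= u -> u < sup S + e -> Q a u.
  by move=> su ue; apply: (Qadd a t u) => //; [lra|exact: Qe].
have [bs|bs] := ltP b (sup S + e); first exact: Qs.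
have : S (sup S + e / 2).
  by split; [apply/andP; split; lra|apply: Qs; lra].
by move=> /(ub_le_sup ubS); lra.
Qed.

Lemma box_connected {R : realType} (a b c d : R) :
  connected (`[a, b] `*` `[c, d]).
Proof.
have [ba|ab] := ltP b a.
  by rewrite set_itv_ge ?set0X ?bnd_simp -?ltNge//; exact: connected0.
have [dc|cd] := ltP d c.
  by rewrite [X in _ `*` X]set_itv_ge ?setX0 ?bnd_simp -?ltNge//;
    exact: connected0.
pose A (s : R) := (pair s @` `[c, d]) `|` ((fun u : R => (u, c)) @` `[a, b]).
have -> : `[a, b] `*` `[c, d] = \bigcup_(s in `[a, b]) A s.
  apply/seteqP; split=> [[s t] [/= sab tcd]|[s t] [u /= uab []]].
  - by exists s => //; left; exists t.
  - by move=> [v vcd [<- <-]].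
  - by move=> [v vab [<- <-]]; split=> //=; rewrite in_itv/= lexx.
apply: bigcup_connected.
  by exists (a, c) => s _; right; exists a => //; rewrite /= in_itv/= lexx.
move=> s sab; apply: connectedU.
- exists (s, c); split; first by exists c => //; rewrite /= in_itv/= lexx.
  by exists s.
- apply: connected_continuous_connected; first exact: segment_connected.
  apply: continuous_subspaceT; apply: pair_continuous; last exact: id_continuous.
  exact: cst_continuous.
- apply: connected_continuous_connected; first exact: segment_connected.
  apply: continuous_subspaceT; apply: pair_continuous; first exact: id_continuous.
  exact: cst_continuous.
Qed.

Lemma box_closed {R : realType} (a b c d : R) : closed (`[a, b] `*` `[c, d]).
Proof.
have -> : `[a, b] `*` `[c, d] = (fst @^-1` `[a, b]) `&` (snd @^-1` `[c, d]).
  by [].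
have cfst : continuous (@fst R R) by move=> x; exact: cvg_fst.
have csnd : continuous (@snd R R) by move=> x; exact: cvg_snd.
by apply: closedI; [move/continuous_closedP: cfst|move/continuous_closedP: csnd];
  apply; exact: itv_closed.
Qed.

Lemma itvUitv {R : realType} (a b c : R) : a <= b -> b <= c ->
  `[a, b] `|` `[b, c] = `[a, c]%classic.
Proof.
move=> ab bc; apply/seteqP; split=> x /=; rewrite !in_itv/=.
  by move=> [] /andP[] *; apply/andP; split; lra.
move=> /andP[ax xc]; have [xb|bx] := leP x b; [left|right];
  apply/andP; split=> //; lra.
Qed.

Lemma itvIitv {R : realType} (a b c : R) : a <= b -> b <= c ->
  `[a, b] `&` `[b, c] = `[b, b]%classic.
Proof.
move=> ab bc; apply/seteqP; split=> x /=; rewrite !in_itv/=.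
  by move=> [] /andP[? ?] /andP[? ?]; apply/andP; split; lra.
by move=> /andP[? ?]; split; apply/andP; split; lra.
Qed.

(** Cousin's lemma is used on the second side, where locality at [y] asks that
    thin strips around the height [y] be liftable, and again on the first side
    to establish this for some thickness. *)
Lemma liftable_box {R : realType} {E X : topologicalType} (p : E -> X)
    (F : R * R -> X) (a b c d : R) :
  covering_map p -> continuous F -> a <= b -> c <= d ->
  liftable p F (`[a, b] `*` `[c, d]).
Proof.
move=> covp cF ab.
move: c d; apply: cousin => [c d e cd de lcd lde|y].
  rewrite -(itvUitv _ _ _ cd de) setXUr; apply: liftableU => //.
  - exact: box_closed.
  - exact: box_closed.
  - rewrite -setXI setIid itvIitv//; exact: box_connected.
  - rewrite -setXI setIid itvIitv//; exists (a, d); split; rewrite /= in_itv/= lexx//.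
move: a b ab; apply: cousin => [a b c ab bc [e1 e10 l1] [e2 e20 l2]|x].
  exists (Num.min e1 e2); first by rewrite lt_min e10.
  move=> s t; rewrite ltrBlDr -ltrBlDl lt_min ltrBlDl -ltrBlDr.
  move=> + sy yt; rewrite -ltrBlDl lt_min => /andP[s1 s2] /andP[t1 t2].
  rewrite -(itvUitv _ _ _ ab bc) setXUl; apply: liftableU => //.
  - exact: box_closed.
  - exact: box_closed.
  - rewrite -setXI setIid itvIitv//; exact: box_connected.
  - rewrite -setXI setIid itvIitv//; exists (b, y).
    by split; rewrite /= in_itv/= ?lexx// sy yt.
  - by apply: l1 => //; lra.
  - by apply: l2 => //; lra.
have [U [oU Ux covU]] := covering_sheet p covp (F (x, y)).
have : nbhs (x, y) (F @^-1` U) by apply: cF; exact: open_nbhs_nbhs.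
move=> [[A B] /= [/nbhs_ballP[e1 /= e10 A1] /nbhs_ballP[e2 /= e20 B2]] ABU].
exists e1 => // s t s1 sx xt t1; exists e2 => // u v u1 uy yv v1.
apply: (liftable_in_covered p F _ U covU); first exact: continuous_subspaceT.
move=> [k l] [/=]; rewrite !in_itv/= => /andP[sk kt] /andP[ul lv].
apply: ABU; split=> /=; [apply: A1|apply: B2]; rewrite /ball/= ltr_norml;
  apply/andP; split; lra.
Qed.

(** Lift the homotopy from the rectangle, starting at [k 0].  The lift restricts
    to [k] on the side [{0} * [0, 1]], and it is constant on the three other
    sides since [F] is; going around the rectangle gives [k 1 = k 0]. *)
Lemma nullhomotopic_lift_closed {R : realType} {E X : topologicalType}
    (p : E -> X) (F : R * R -> X) (k : R -> E) (x : X) :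
  covering_map p -> continuous F -> continuous k ->
  (forall t, t \in `[0, 1] -> p (k t) = F (0, t)) ->
  (forall t, t \in `[0, 1] -> F (1, t) = x) ->
  (forall s, s \in `[0, 1] -> F (s, 0) = x /\ F (s, 1) = x) ->
  k 0 = k 1.
Proof.
move=> covp cF ck pk F1 F01.
have i0 : `[0, 1]%classic (0 : R) by rewrite /= in_itv/= lexx ler01.
have i1 : `[0, 1]%classic (1 : R) by rewrite /= in_itv/= lexx ler01.
have [L [cL L00 pL]] := liftable_box p F 0 1 0 1 covp cF ler01 ler01
  (0, 0) (k 0) (conj i0 i0) (pk _ i0).
(* Along a path [u] in the rectangle, a known lift [w] of [F \o u] that agrees
   with [L \o u] at one time does so at all times; it is applied to the four
   sides. *)
have edge (u : R -> R * R) (w : R -> E) : continuous u ->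
    (forall t, `[0, 1]%classic t -> (`[0, 1] `*` `[0, 1]) (u t)) ->
    continuous w -> (forall t, `[0, 1]%classic t -> p (w t) = F (u t)) ->
    forall s t, `[0, 1]%classic s -> `[0, 1]%classic t ->
    w s = L (u s) -> w t = L (u t).
  move=> cu uI cw pw s t Is It ws.
  apply: (lift_unique (S := R) p `[0, 1]%classic w (L \o u) s) => //.
  - exact: segment_connected.
  - exact: continuous_subspaceT.
  - move: cL => /subspace_continuousP cL; apply/subspace_continuousP => r Ir.
    apply: cvg_comp (cL _ (uI _ Ir)) => V; rewrite !nbhs_simpl/= /within/=.
    move=> /cu; rewrite nbhs_simpl/=; apply: filterS => q + Iq; apply.
    exact: uI.
  - by move=> r Ir; rewrite pw// pL//; exact: uI.
have vert (s : R) : continuous (fun t : R => (s, t)).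
  by apply: pair_continuous; [exact: cst_continuous|exact: id_continuous].
have horz (t : R) : continuous (fun s : R => (s, t)).
  by apply: pair_continuous; [exact: id_continuous|exact: cst_continuous].
have cc e : continuous (fun _ : R => e : E) by exact: cst_continuous.
have k0x : p (k 0) = x by rewrite pk//; have [] := F01 _ i0.
have e1 : k 1 = L (0, 1).
  by apply: (edge _ _ (vert 0) _ ck _ 0 1) => //= t It; exact: pk.
have e2 : k 0 = L (1, 0).
  apply: (edge _ _ (horz 0) _ (cc (k 0)) _ 0 1) => //= t It.
  by rewrite k0x; have [] := F01 _ It.
have e3 : k 0 = L (1, 1).
  apply: (edge _ _ (vert 1) _ (cc (k 0)) _ 0 1) => //= t It.
  by rewrite k0x F1.
rewrite e1; apply: (edge _ _ (horz 1) _ (cc (k 0)) _ 1 0) => //= t It.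
by rewrite k0x; have [] := F01 _ It.
Qed.

(** * Paths *)

(** Precomposition with [clamp] turns maps that are only continuous within
    [[0, 1]] into continuous maps on the whole line. *)
Definition clamp {R : realType} (t : R) : R := Num.max 0 (Num.min 1 t).

Lemma clamp_itv {R : realType} (t : R) : clamp t \in `[0, 1].
Proof. by rewrite in_itv/= le_max lexx/= ge_max ler01 ge_min lexx. Qed.

Lemma clampK {R : realType} (t : R) : t \in `[0, 1] -> clamp t = t.
Proof.
by rewrite in_itv/= => /andP[t0 t1]; rewrite /clamp (min_idPr t1) (max_idPr t0).
Qed.

Lemma clamp_continuous {R : realType} : continuous (@clamp R).
Proof.
move=> t; apply: (@continuous_max R R (fun=> 0) (Num.min 1)).
  exact: cst_continuous.
apply: (@continuous_min R R (fun=> 1) id); first exact: cst_continuous.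
exact: cvg_id.
Qed.

Lemma within_continuous_into {S T U : topologicalType} (A : set T)
    (u : S -> T) (f : T -> U) :
  continuous u -> (forall s, A (u s)) -> {within A, continuous f} ->
  continuous (f \o u).
Proof.
move=> cu uA /subspace_continuousP cf s.
apply: cvg_comp (cf _ (uA s)) => V; rewrite !nbhs_simpl/= /within/=.
by move=> /cu; rewrite nbhs_simpl/=; apply: filterS => q; apply.
Qed.

(** The path is lifted as a map of the unit square that does not depend on the
    second coordinate. *)
Lemma path_lift {R : realType} {E X : topologicalType} (p : E -> X)
    (c : R -> X) (e : E) : covering_map p -> continuous c -> p e = c 0 ->
  exists k : R -> E,
    [/\ continuous k, k 0 = e & forall t, p (k t) = c (clamp t)].
Proof.
move=> covp cc pe.
have i0 : (0 : R) \in `[0, 1] by rewrite in_itv/= lexx ler01.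
have cF : continuous (c \o @fst R R).
  by move=> x; apply: continuous_comp; [exact: cvg_fst|exact: cc].
have [L [cL L0 pL]] := liftable_box p (c \o @fst R R) 0 1 0 1 covp cF
  ler01 ler01 (0, 0) e (conj i0 i0) pe.
exists (L \o (fun t => (clamp t, 0))); split.
- apply: within_continuous_into cL.
    by apply: pair_continuous; [exact: clamp_continuous|exact: cst_continuous].
  by move=> t; split=> //; exact: clamp_itv.
- by rewrite /= clampK.
- by move=> t; apply: (pL (clamp t, 0)); split=> //; exact: clamp_itv.
Qed.

(** Paths are defined on the whole line, so that composing and reversing them
    needs no continuity within a subset. *)
Definition joined (R : realType) {T : topologicalType} (A : set T)
    (x y : T) : Prop :=
  exists c : R -> T, [/\ continuous c, c 0 = x, c 1 = y & forall t, A (c t)].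

Lemma joined_within {R : realType} {T : topologicalType} (A : set T)
    (c : R -> T) :
  {within `[0, 1], continuous c} -> (forall t, t \in `[0, 1] -> A (c t)) ->
  joined R A (c 0) (c 1).
Proof.
move=> cc cA; exists (c \o clamp); split.
- by apply: within_continuous_into cc; [exact: clamp_continuous|exact: clamp_itv].
- by rewrite /= clampK// in_itv/= lexx ler01.
- by rewrite /= clampK// in_itv/= lexx ler01.
- by move=> t; apply/cA/clamp_itv.
Qed.

Lemma joined_sym {R : realType} {T : topologicalType} (A : set T) x y :
  joined R A x y -> joined R A y x.
Proof.
move=> [c [cc c0 c1 cA]]; exists (c \o (fun t => 1 - t)); split=> //=.
- move=> t; apply: continuous_comp; last exact: cc.
  by apply: cvgB; [exact: cvg_cst|exact: cvg_id].
- by rewrite subr0.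
- by rewrite subrr.
Qed.

Lemma joined_trans {R : realType} {T : topologicalType} (A : set T) x y z :
  joined R A x y -> joined R A y z -> joined R A x z.
Proof.
move=> [c [cc c0 c1 cA]] [d [cd d0 d1 dA]].
pose f t := c (clamp (2 * t)); pose g t := d (clamp (2 * t - 1)).
have c2 : continuous (fun t : R => 2 * t).
  by move=> t; apply: cvgM; [exact: cvg_cst|exact: cvg_id].
have cf : continuous f.
  move=> t; apply: continuous_comp; last exact: cc.
  by apply: continuous_comp; [exact: c2|exact: clamp_continuous].
have cg : continuous g.
  move=> t; apply: continuous_comp; last exact: cd.
  apply: continuous_comp; last exact: clamp_continuous.
  by apply: cvgB; [exact: c2|exact: cvg_cst].
pose h t := if t <= 1 / 2 then f t else g t.
have hf t : t <= 1 / 2 -> h t = f t by rewrite /h => ->.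
have hg t : 1 / 2 <= t -> h t = g t.
  move=> t1; rewrite /h; case: ifPn => // t2.
  have -> : t = 1 / 2 by lra.
  rewrite /f /g mulrC divfK// subrr !clampK ?in_itv/= ?lexx ?ler01//.
  by rewrite c1 d0.
exists h; split.
- apply/continuous_subspace_setT.
  have -> : [set: R] = [set t | t <= 1 / 2] `|` [set t | 1 / 2 <= t].
    by apply/seteqP; split=> t //= _; have [|] := leP t (1 / 2);
      [left|right; exact: ltW].
  apply: withinU_continuous.
  + exact: closed_le.
  + exact: closed_ge.
  + apply: subspace_eq_continuous (continuous_subspaceT cf) => t /set_mem/=.
    by move=> /hf/esym.
  + apply: subspace_eq_continuous (continuous_subspaceT cg) => t /set_mem/=.
    by move=> /hg/esym.
- by rewrite /h ifT ?divr_ge0// /f mulr0 clampK// in_itv/= lexx ler01.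
- rewrite hg; last by lra.
  rewrite /g mulr1 (_ : 2 - 1 = 1); last by lra.
  by rewrite clampK// in_itv/= lexx ler01.
- by move=> t; rewrite /h; case: ifP => _; [exact: cA|exact: dA].
Qed.

Lemma joined_image {R : realType} {S T : topologicalType} (A : set S)
    (B : set T) (f : S -> T) x y :
  {in A, continuous f} -> (forall s, A s -> B (f s)) ->
  joined R A x y -> joined R B (f x) (f y).
Proof.
move=> cf fAB [c [cc <- <- cA]]; exists (f \o c); split=> //.
- move=> t; apply: continuous_comp; first exact: cc.
  by apply: cf; exact/mem_set.
- by move=> t; exact/fAB.
Qed.

Definition locally_path_connected (R : realType) (T : topologicalType) : Prop :=
  forall (x : T) (O : set T), nbhs x O -> \forall y \near x, joined R O x y.

(** * The lifting criterion *)
Lemma covering_locally_path_connected (R : realType) {E X : topologicalType}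
    (p : E -> X) :
  covering_map p -> locally_path_connected R X -> locally_path_connected R E.
Proof.
move=> covp lX e O /nbhs_interior Oe.
have [U [oU Ue /(_ _ Ue) [V [s [Ve [_ oV cs Us Vs]]]]]] :=
  covering_sheet p covp (p e).
have [_ se] := Vs _ Ve.
pose W := U `&` s @^-1` O°.
have Wpe : nbhs (p e) W.
  apply: filterI; first exact: open_nbhs_nbhs.
  by apply: (cs (p e)); [exact: mem_set|rewrite se].
have [cp _ _] := covp; have := cp e _ (lX _ _ Wpe).
rewrite nbhs_simpl/= => nW; near=> y.
have Vy : V y by near: y; exact: open_nbhs_nbhs.
rewrite -se; have [_ <-] := Vs _ Vy.
apply: (@joined_image _ _ _ W); last by near: y.
- by move=> x /set_mem [Ux _]; apply: cs; exact: mem_set.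
- by move=> x [_ /interior_subset].
Unshelve. all: by end_near. Qed.

(** The graph of the lift is the relation [J], path connectedness to [(z0, e0)]
    in the fibre product [P].  Functionality is proved by applying [nullhomotopic_lift_closed] to
    a path of [P] from [(z, e)] to [(z, e')], whose first coordinate is a loop
    and whose second coordinate lifts the image of this loop. *)
Lemma lifting_criterion (R : realType) {E X S : topologicalType} (p : E -> X)
    (g : S -> X) (z0 : S) (e0 : E) :
  covering_map p -> simply_connected R S -> locally_path_connected R S ->
  continuous g -> p e0 = g z0 ->
  exists G : S -> E, [/\ continuous G, G z0 = e0 & forall z, p (G z) = g z].
Proof.
move=> covp [_ pathS loopS] lS cg pe0.
pose P : set (S * E) := [set w | p w.2 = g w.1].
pose J z e := joined R P (z0, e0) (z, e).
have Jfun z e e' : J z e -> J z e' -> e = e'.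
  move=> /joined_sym Je /(joined_trans _ _ _ _ Je) [c [cc c0 c1 cP]].
  have cc1 : continuous (fst \o c).
    by move=> t; apply: continuous_comp; [exact: cc|exact: cvg_fst].
  have cc2 : continuous (snd \o c).
    by move=> t; apply: continuous_comp; [exact: cc|exact: cvg_snd].
  have [||H [cH H0 H1 H01]] :=
    loopS z (fst \o c) (continuous_subspaceT cc1); rewrite /= ?c0 ?c1//.
  pose cl2 (w : R * R) := (clamp w.1, clamp w.2).
  have cl2E (s t : R) : s \in `[0, 1] -> t \in `[0, 1] -> cl2 (s, t) = (s, t).
    by move=> Is It; rewrite /cl2/= !clampK.
  have i0 : (0 : R) \in `[0, 1] by rewrite in_itv/= lexx ler01.
  have i1 : (1 : R) \in `[0, 1] by rewrite in_itv/= lexx ler01.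
  have cF : continuous (g \o (H \o cl2)).
    move=> w; apply: continuous_comp; last exact: cg.
    apply: within_continuous_into cH w.
      by apply: pair_continuous => w; apply: continuous_comp;
        [exact: cvg_fst|exact: clamp_continuous|
         exact: cvg_snd|exact: clamp_continuous].
    by move=> w; split; exact: clamp_itv.
  have := nullhomotopic_lift_closed p _ (snd \o c) (g z) covp cF cc2.
  rewrite /= c0 c1; apply.
  - by move=> t It; rewrite cl2E// H0//; exact: cP.
  - by move=> t It; rewrite cl2E// H1.
  - by move=> s Is; rewrite !cl2E//; have [-> ->] := H01 _ Is.
have Jtot z : exists e, J z e.
  have [c0 [cc0 c00 c01]] := pathS z0 z.
  have [|c [cc c_0 c_1 _]] := joined_within setT c0 cc0; first by [].
  have cgc : continuous (g \o c).
    by move=> t; apply: continuous_comp; [exact: cc|exact: cg].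
  have [|k [ck k0 pk]] := path_lift p (g \o c) e0 covp cgc.
    by rewrite /= c_0 c00.
  exists (k 1); exists (fun t => (c (clamp t), k t)); split.
  - apply: pair_continuous => //.
    by move=> t; apply: continuous_comp; [exact: clamp_continuous|exact: cc].
  - by rewrite clampK ?in_itv/= ?lexx ?ler01// c_0 c00 k0.
  - by rewrite clampK ?in_itv/= ?lexx ?ler01// c_1 c01.
  - by move=> t; rewrite /P/= pk.
have [G JG] := choice Jtot.
have PG z : p (G z) = g z by have [c [_ _ c1 /(_ 1)]] := JG z; rewrite c1.
exists G; split=> //; last first.
  apply: (Jfun _ _ _ (JG z0)); exists (cst (z0, e0)); split=> //.
  exact: cst_continuous.
move=> z; have [U [oU Ue /(_ _ Ue) [V [s [Ve [_ oV cs Us Vs]]]]]] :=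
  covering_sheet p covp (p (G z)).
have [_ se] := Vs _ Ve; rewrite PG in Ue se.
pose O := g @^-1` U.
have Oz : nbhs z O by apply: cg; exact: open_nbhs_nbhs.
have csg : {in O, continuous (s \o g)}.
  move=> y /set_mem Oy; apply: continuous_comp; first exact: cg.
  by apply: cs; exact: mem_set.
have GE : \forall y \near z, G y = s (g y).
  apply: filterS (lS _ _ Oz) => y zy; apply: (Jfun _ _ _ (JG y)).
  apply: joined_trans (JG z) _; rewrite -{1}se.
  apply: (joined_image O P (fun y => (y, s (g y)))) zy.
  - by move=> x Ox; apply: cvg_pair; [exact: cvg_id|exact: csg].
  - by move=> x Ox; have [] := Us _ Ox.
move=> W; rewrite -{1}se => sW.
have nsW : nbhs z ((s \o g) @^-1` W).
  by apply: csg sW; apply/mem_set; exact: nbhs_singleton Oz.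
by rewrite nbhs_simpl/=; apply: filterS2 nsW GE => y /= sWy Gy; rewrite Gy.
Qed.

(** * Local topology of polyhedra *)
Lemma cvg_ptws {I : Type} {K : topologicalType} (F : set_system {ptws I -> K})
    (x : {ptws I -> K}) :
  Filter F -> (forall i, (fun y : {ptws I -> K} => y i) @ F --> x i) -> F --> x.
Proof.
move=> FF Fx; apply/cvg_sup => i U /= [_ /= [[W oW <-] Wx WU]].
by apply: filterS WU _; apply: (Fx i); exact: open_nbhs_nbhs.
Qed.

Lemma ptws_continuous {T : topologicalType} {I : Type} {K : topologicalType}
    (f : T -> {ptws I -> K}) :
  (forall i, continuous (fun t => f t i)) -> continuous f.
Proof. by move=> cf t; apply: cvg_ptws => i; exact: cf. Qed.

Lemma ptws_eval_continuous {I : eqType} {K : topologicalType} (i : I) :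
  continuous (fun y : {ptws I -> K} => y i).
Proof. exact: (@proj_continuous I (fun=> K) i). Qed.

Lemma set_type_continuous {T Y : topologicalType} (A : set Y)
    (f : T -> set_type A) :
  continuous (\val \o f) -> continuous f.
Proof. exact: continuous_comp_initial. Qed.

Lemma val_continuous {Y : topologicalType} (A : set Y) :
  continuous (\val : set_type A -> Y).
Proof. exact: initial_continuous. Qed.

(** The statement is that the filter of uniform balls around [x] converges to
    [x]; for this, pointwise convergence is enough. *)
Lemma ptws_nbhs_ball {R : realType} {V : Type} (x : {ptws V -> R})
    (O : set {ptws V -> R}) : nbhs x O ->
  exists2 e, 0 < e & forall y : {ptws V -> R},
    (forall v, `|x v - y v| < e) -> O y.
Proof.
pose F := filter_from [set e : R | 0 < e]
  (fun e => [set y : {ptws V -> R} | forall v, `|x v - y v| < e]).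
have FF : Filter F.
  apply: filter_from_filter; first by exists 1 => /=.
  move=> a b /= a0 b0; exists (Num.min a b); first by rewrite /= lt_min a0.
  by move=> y /= yab; split=> v; have := yab v; rewrite lt_min => /andP[].
have Fx : F --> x.
  apply: cvg_ptws => v W /nbhs_ballP[e /= e0 eW]; exists e => //= y /= xy.
  exact/eW/xy.
by move=> /Fx.
Qed.

(** A point [y] close to [x] has a support containing that of [x], since the
    nonzero coordinates of [x] remain nonzero.  The segment from [x] to [y] is
    then supported in the support of [y], so it does not leave [K]; nor does it
    leave a ball around [x] that contains [y]. *)
Lemma realization_locally_path_connected (R : realType) (V : finType)
    (K : {set {set V}}) :
  simplicial_complex K ->
  locally_path_connected R (set_type (@realization R V K)).
Proof.
move=> [_ Ksub] x O [_ /= [[B oB <-] Bx BO]].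
have [e e0 eB] := ptws_nbhs_ball _ _ (open_nbhs_nbhs (conj oB Bx)).
have cv v : continuous (fun y : set_type (@realization R V K) => \val y v).
  move=> y; apply: (@continuous_comp _ _ _ _ (fun z : {ptws V -> R} => z v)).
    exact: val_continuous.
  exact: ptws_eval_continuous.
have xK := set_mem (valP x).
have nxy : \forall y \near x, forall v,
    `|\val x v - \val y v| < e /\ (\val x v != 0 -> \val y v != 0).
  apply: (@filter_forall _ V (fun v => [set y : set_type (@realization R V K) |
    `|\val x v - \val y v| < e /\ (\val x v != 0 -> \val y v != 0)]) (nbhs x)).
  move=> v.
  have n1 : nbhs x [set y | `|\val x v - \val y v| < e] := cv v x [set r | `|\val x v - r| < e]
    (nbhsx_ballx (\val x v : R) e e0).
  have [xv0|xv0] := eqVneq (\val x v) 0.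
    by apply: filterS n1 => y /= ye; split.
  have n2 : nbhs x [set y | \val y v != 0] := cv v x [set r | r != 0]
    (@open_nbhs_nbhs R (\val x v) [set r | r != 0] (conj (@open_neq R 0) xv0)).
  by apply: filterS2 n1 n2 => y.
apply: filterS nxy => y xy.
(* Clamping the time makes [seg] take its values in the realization for all
   real [t]. *)
pose seg (t : R) : {ptws V -> R} :=
  fun v => \val x v + clamp t * (\val y v - \val x v).
have yK := set_mem (valP y).
have segK t : seg t \in @realization R V K.
  have := clamp_itv t; rewrite in_itv/= /seg => /andP[t0 t1].
  have [x0 sx sxK] := xK; have [y0 sy syK] := yK; apply/mem_set; split.
  - by move=> v; have := x0 v; have := y0 v; nra.
  - rewrite big_split/= -mulr_sumr sumrB.
    by have := sx; have := sy => /= -> ->; rewrite subrr mulr0 addr0.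
  - apply: (Ksub _ _ syK).
      apply/fintype.subsetP => v; rewrite !inE; apply: contraNN => /eqP yv0.
      have /eqP xv0 : \val x v == 0.
        by apply: contraT => /(proj2 (xy v)); rewrite yv0 eqxx.
      by rewrite xv0 yv0 subrr mulr0 addr0.
    apply/negP => /eqP s0.
    have : \sum_v seg t v = 1.
      rewrite big_split/= -mulr_sumr sumrB.
      by have := sx; have := sy => /= -> ->; rewrite subrr mulr0 addr0.
    rewrite big1 => [/eqP|v _]; first by rewrite eq_sym oner_eq0.
    apply/eqP/negPn/negP => sv.
    by have := finset.in_set0 v; rewrite -s0 inE /seg sv.
exists (fun t => exist _ (seg t) (segK t)); split.
- apply: set_type_continuous; apply: ptws_continuous => v t /=.
  apply: cvgD; first exact: cvg_cst.
  by apply: cvgM; [exact: clamp_continuous|exact: cvg_cst].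
- apply: val_inj => /=; apply/funext => v.
  by rewrite /seg clampK ?mul0r ?addr0// in_itv/= lexx ler01.
- apply: val_inj => /=; apply/funext => v.
  by rewrite /seg clampK ?mul1r 1?addrC ?subrK// in_itv/= lexx ler01.
- move=> t; apply: BO => /=; apply: eB => v; rewrite /seg.
  have := clamp_itv t; rewrite in_itv/= => /andP[t0 t1].
  rewrite opprD addrA subrr sub0r normrN normrM (ger0_norm t0).
  have [xye _] := xy v; rewrite distrC.
  by apply: le_lt_trans xye; rewrite ler_piMl.
Qed.

Lemma homeomorphism_locally_path_connected (R : realType)
    {X Y : topologicalType} (h : X -> Y) :
  homeomorphism h -> locally_path_connected R Y -> locally_path_connected R X.
Proof.
move=> [ch [k [ck hk kh]]] lY x O Ox.
have kO : nbhs (h x) (k @^-1` O) by apply: ck; rewrite hk.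
have := ch x _ (lY _ _ kO); rewrite nbhs_simpl/=; apply: filterS => y xy.
by rewrite -(hk x) -(hk y); apply: joined_image xy.
Qed.

Lemma injective_hausdorff {X Y : topologicalType} (h : X -> Y) :
  continuous h -> injective h -> hausdorff_space Y -> hausdorff_space X.
Proof.
move=> ch ih hY x y xy; apply/ih/hY => A B Ax By.
by have [z [Az Bz]] := xy _ _ (ch _ _ Ax) (ch _ _ By); exists (h z).
Qed.

Lemma polyhedron_locally_path_connected (R : realType) (X : topologicalType) :
  finite_polyhedron R X -> locally_path_connected R X.
Proof.
move=> [V [K [sK [h hh]]]]; apply: (homeomorphism_locally_path_connected R h hh).
exact: realization_locally_path_connected.
Qed.

Lemma polyhedron_hausdorff (R : realType) (X : topologicalType) :
  finite_polyhedron R X -> hausdorff_space X.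
Proof.
move=> [V [K [_ [h [ch [k [_ hk _]]]]]]].
apply: (injective_hausdorff (\val \o h)).
- by move=> x; apply: continuous_comp; [exact: ch|exact: val_continuous].
- by move=> x y /val_inj/(can_inj hk).
- by apply: hausdorff_product => _; exact: Rhausdorff.
Qed.

(** * Lift-factors of a split map *)
Lemma path_connected_connected (R : realType) (T : topologicalType) :
  path_connected R T -> connected [set: T].
Proof.
move=> pT; have [[x _]|] := pselect (exists x : T, True); last first.
  move=> nT; have -> : [set: T] = set0; last exact: connected0.
  by apply/seteqP; split=> // y _; case: nT; exists y.
have i0 : `[0, 1]%classic (0 : R) by rewrite /= in_itv/= lexx ler01.
have i1 : `[0, 1]%classic (1 : R) by rewrite /= in_itv/= lexx ler01.
have [c cP] := choice (pT x).
have -> : [set: T] = \bigcup_y (c y @` `[0, 1]).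
  apply/seteqP; split=> // y _; exists y => //; have [_ _ c1] := cP y.
  by exists 1.
apply: bigcup_connected.
  exists x => y _; have [_ c0 _] := cP y.
  by exists 0.
move=> y _; have [cc _ _] := cP y.
by apply: connected_continuous_connected => //; exact: segment_connected.
Qed.

Lemma closed_agreement {S T : topologicalType} (u v : S -> T) :
  hausdorff_space T -> continuous u -> continuous v ->
  closed [set z | u z = v z].
Proof.
move=> hT cu cv z clz; apply: hT => A B uA vB.
have zA : nbhs z (u @^-1` A) := cu _ _ uA.
have zB : nbhs z (v @^-1` B) := cv _ _ vB.
have [y [/= uv [Ay By]]] := clz _ (filterI zA zB).
by exists (u y); split=> //; rewrite uv.
Qed.

(** The members of the partition are also open, there being finitely many of
    them. *)
Lemma connected_closed_partition {T : topologicalType} {I : finType}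
    (C : I -> set T) :
  connected [set: T] -> inhabited T -> (forall i, closed (C i)) ->
  trivIset setT C -> (forall z, exists i, C i z) -> exists i, C i = setT.
Proof.
move=> cT [z0] clC tC covC; have [i Ciz0] := covC z0.
exists i; apply: cT; [by exists z0| |by exists (C i); rewrite ?setTI].
exists (C i); rewrite ?setTI// openE => z Ciz.
have nC j : \forall y \near z, j != i -> ~ C j y.
  have [->|ji] := eqVneq j i; first by apply: nearW.
  have : nbhs z (~` C j).
    apply: open_nbhs_nbhs; split; first exact: closed_openC.
    by move=> Cjz; move/eqP: ji; apply; apply: tC => //; exists z.
  by apply: filterS.
have nC' := @filter_forall _ I (fun j y => j != i -> ~ C j y) _
  (nbhs_filter z) nC.
suff : nbhs z (C i) by [].
apply: filterS nC' => y nCy; have [j Cjy] := covC y.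
by have [<-//|/nCy] := eqVneq j i.
Qed.

(** The [n] points [fs i x] exhaust a set with [n] elements: choosing an index
    for each element gives an injection of ['I_n] into itself, hence a
    bijection. *)
Lemma splitting_injective n (X : topologicalType) (f : X -> Dn n X)
    (fs : 'I_n -> X -> X) (x : X) :
  splitting f fs -> injective (fs^~ x).
Proof.
move=> [_ fsE]; have [y yE] := Dn_pi_surj (f x).
have yF := set_mem (valP y).
have /choice[s sE] : forall j, exists i, fs i x = (\val y : 'I_n -> X) j.
  move=> j; have : points (f x) (\val y j) by rewrite /points -yE /=; exists j.
  by rewrite fsE => -[i _ <-]; exists i.
have sI : injective s.
  move=> j k sjk; apply/eqP/negPn/negP => /yF; apply.
  by rewrite -!sE sjk.
have [t st ts] := injF_bij sI.
move=> i k; rewrite /= -(ts i) -(ts k) !sE => e; congr s.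
by apply/eqP/negPn/negP => /yF; apply.
Qed.

Definition lifts {E X : topologicalType} (p : E -> X) (g : X -> X) :
    set (E -> E) :=
  [set h | continuous h /\ p \o h = g \o p].

Lemma lift_factor_lifts {R : realType} {X E : topologicalType} (p : E -> X)
    {n : nat} (f : X -> Dn n X) (fs : 'I_n -> X -> X) (h : E -> E) :
  finite_polyhedron R X -> universal_covering R p -> splitting f fs ->
  lift_factor p f h -> exists i, lifts p (fs i) h.
Proof.
move=> hX hp hfs [fbar [k [[cfbar fbarE] hE]]].
have [[cp _ _] [E0 pcE _]] := hp; have [cfs fsE] := hfs.
have ch : continuous h.
  have -> : h = (fun y : {ptws 'I_n -> E} => y k) \o (\val \o fbar).
    by apply/funext => z; rewrite hE.
  move=> z; apply: continuous_comp; last exact: ptws_eval_continuous.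
  by apply: continuous_comp; [exact: cfbar|exact: val_continuous].
pose C i := [set z | p (h z) = fs i (p z)].
have [||z|i Ci] := connected_closed_partition C
    (path_connected_connected R _ pcE) E0.
- move=> i; apply: closed_agreement; first exact: polyhedron_hausdorff hX.
    by move=> z; apply: continuous_comp; [exact: ch|exact: cp].
  by move=> z; apply: continuous_comp; [exact: cp|exact: cfs].
- move=> i j _ _ [z [Ciz Cjz]].
  exact: (splitting_injective _ _ _ _ (p z) hfs) (etrans (esym Ciz) Cjz).
- have : points (f (p z)) (p (h z)) by rewrite -fbarE hE; exists k.
  by rewrite fsE => -[i _ iE]; exists i.
- exists i; split=> //; apply/funext => z /=.
  by have : C i z by rewrite Ci.
Qed.

(** The chosen lift [h] is completed with arbitrary lifts of the other [fs j].
    A coordinate is never the image of another one by a deck transformation,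
    since their projections [fs j (p z)] and [fs k (p z)] differ. *)
Lemma lifts_lift_factor {R : realType} {X E : topologicalType} (p : E -> X)
    {n : nat} (f : X -> Dn n X) (fs : 'I_n -> X -> X) (h : E -> E) (i : 'I_n) :
  finite_polyhedron R X -> universal_covering R p -> splitting f fs ->
  lifts p (fs i) h -> lift_factor p f h.
Proof.
move=> hX hp hfs [ch ph]; have [covp sE] := hp; have [cp sp _] := covp.
have [[z0] _ _] := sE; have [cfs fsE] := hfs.
have /choice[hs hsE] : forall j, exists g, lifts p (fs j) g /\ (j = i -> g = h).
  move=> j; have [->|ji] := eqVneq j i; first by exists h.
  have [e0 _ pe0] : range p (fs j (p z0)) by rewrite sp.
  have cfsp : continuous (fs j \o p).
    by move=> z; apply: continuous_comp; [exact: cp|exact: cfs].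
  have lE := covering_locally_path_connected R p covp
    (polyhedron_locally_path_connected R X hX).
  have [G [cG _ pG]] :=
    lifting_criterion R p (fs j \o p) z0 e0 covp sE lE cfsp pe0.
  exists G; split; first by split=> //; apply/funext.
  by move=> ji'; rewrite ji' eqxx in ji.
have phs j z : p (hs j z) = fs j (p z).
  by have [[_ /(congr1 (@^~ z))]] := hsE j.
have hsF z : (fun j => hs j z : E) \in @Fn_deck _ _ p n.
  apply/mem_set => j k a jk [_ pa] /(congr1 p).
  rewrite -[p (a _)]/((p \o a) _) pa !phs => /(splitting_injective _ _ _ _ _ hfs).
  by apply/eqP.
pose fbar z : set_type (@Fn_deck _ _ p n) :=
  exist _ ((fun j => hs j z) : {ptws 'I_n -> E}) (hsF z).
exists fbar, i; split; last first.
  by move=> z /=; have [_ ->] := hsE i.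
split.
- apply: set_type_continuous; apply: ptws_continuous => j.
  by have [[]] := hsE j.
- move=> z; rewrite fsE; apply/seteqP; split=> _ [j _ <-]; exists j => //=;
    by rewrite phs.
Qed.

Lemma lift_factorE {R : realType} {X E : topologicalType} (p : E -> X)
    {n : nat} (f : X -> Dn n X) (fs : 'I_n -> X -> X) :
  finite_polyhedron R X -> universal_covering R p -> splitting f fs ->
  lift_factor p f = \bigcup_i lifts p (fs i).
Proof.
move=> hX hp hfs; apply/seteqP; split=> h.
  by move=> /(lift_factor_lifts p f fs h hX hp hfs)[i]; exists i.
by move=> [i _]; exact: (lifts_lift_factor p f fs h i hX hp hfs).
Qed.

Lemma lifts_disjoint {X E : topologicalType} (p : E -> X)
    {n : nat} (f : X -> Dn n X) (fs : 'I_n -> X -> X) (i j : 'I_n)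
    (h : E -> E) :
  inhabited E -> splitting f fs ->
  p \o h = fs i \o p -> p \o h = fs j \o p -> i = j.
Proof.
move=> [z] hfs ph ph'.
apply: (splitting_injective _ _ _ _ (p z) hfs).
by have := congr1 (@^~ z) ph; rewrite ph'.
Qed.

(** * Counting conjugacy classes *)

(** Both [a] and its inverse [b] are over the identity of [X], so that
    [p \o (a \o h' \o b) = p \o h' \o b = g \o p \o b = g \o p]. *)
Lemma deck_conjugate_lifts {E X : topologicalType} (p : E -> X) (g : X -> X)
    (h h' : E -> E) :
  deck_conjugate p h h' -> p \o h' = g \o p -> p \o h = g \o p.
Proof.
move=> [a [b [[_ pa] ab ba ->]]] ph'; apply/funext => z /=.
rewrite -[p (a _)]/((p \o a) _) pa -[p (h' _)]/((p \o h') _) ph' /=.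
by rewrite -[in LHS]pa /= ba.
Qed.

Lemma deck_conjugate_refl {E X : topologicalType} (p : E -> X) h :
  deck_conjugate p h h.
Proof.
exists id, id; split=> //; split=> //; split; first by move=> x; exact: cvg_id.
by exists id; split=> // x; exact: cvg_id.
Qed.

(** Conjugate maps lie in the same [L i], so the class of an element of [L i]
    is the same computed in [L i] or in the union; as a class contains the
    element that defines it, it comes from a single [i]. *)
Lemma conjugacy_classes_bigcup {E X : topologicalType} (p : E -> X)
    {I : Type} (L : I -> set (E -> E)) :
  (forall i j h h', L i h -> L j h' -> deck_conjugate p h h' -> i = j) ->
  conjugacy_classes p (\bigcup_i L i) = \bigcup_i conjugacy_classes p (L i) /\
  trivIset setT (fun i => conjugacy_classes p (L i)).
Proof.
move=> Lsep; split.
  have clE i h : L i h -> [set h' | (\bigcup_i L i) h' /\ deck_conjugate p h h'] =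
      [set h' | L i h' /\ deck_conjugate p h h'].
    move=> Lh; apply/seteqP; split=> h'.
      by move=> [[j _ Lh'] hh']; rewrite (Lsep _ _ _ _ Lh Lh' hh').
    by move=> [Lh' hh']; split=> //; exists i.
  apply/seteqP; split=> C.
    by move=> [h [i _ Lh] <-]; exists i => //; exists h => //; rewrite (clE i h Lh).
  by move=> [i _ [h Lh <-]]; exists h; [exists i|rewrite (clE i h Lh)].
move=> i j _ _ [C [[h Lh <-] [h' Lh' CE]]].
have [Ljh _] : [set h0 | L j h0 /\ deck_conjugate p h' h0] h.
  by rewrite CE; split=> //; exact: deck_conjugate_refl.
exact: Lsep Lh Ljh (deck_conjugate_refl p h).
Qed.

Lemma counting_setU {R : realType} {T : choiceType} (A B : set T) :
  A `&` B = set0 ->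
  (counting (A `|` B) = counting A + counting B :> \bar R)%E.
Proof.
move=> AB0; rewrite /counting.
case: (asboolP (finite_set A)) => fA; last first.
  rewrite asboolF; last by rewrite finite_setU => -[].
  by rewrite addye//; case: ifP.
case: (asboolP (finite_set B)) => fB; last first.
  by rewrite asboolF ?finite_setU => [|[]].
rewrite asboolT ?finite_setU// fset_setU// -EFinD -natrD finmap.cardfsU.
by rewrite -fset_setI// AB0 fset_set0 finmap.cardfs0 subn0.
Qed.

Lemma counting_bigcup {R : realType} {T : choiceType} n (A : 'I_n -> set T) :
  trivIset setT A ->
  (counting (\bigcup_i A i) = \sum_(i < n) counting (A i) :> \bar R)%E.
Proof.
elim: n A => [|n IHn] A tA.
  rewrite big_ord0 (_ : \bigcup_i A i = set0).
    by rewrite /counting asboolT ?fset_set0.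
  by apply/seteqP; split=> // x [[]].
have -> : \bigcup_i A i = A ord0 `|` \bigcup_i A (lift ord0 i).
  apply/seteqP; split=> x.
    move=> [i _]; case: (unliftP ord0 i) => [j ->|->]; last by left.
    by right; exists j.
  by move=> [Ax|[j _ Ax]]; [exists ord0|exists (lift ord0 j)].
rewrite big_ord_recl counting_setU ?IHn//.
  move=> i j _ _ [x [Ax Bx]]; apply: (@lift_inj _ ord0).
  by apply: tA => //; exists x.
apply/seteqP; split=> // x [Ax [j _ Bx]].
suff : ord0 = lift ord0 j by move/eqP; rewrite (negbTE (neq_lift _ _)).
by apply: tA => //; exists x.
Qed.

Theorem theorem8p3 (R : realType) (X E : topologicalType) (p : E -> X)
    (hX : finite_polyhedron R X) (cX : connected [set: X])
    (hp : universal_covering R p)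
    (n : nat) (hn : (1 <= n)%N)
    (f : X -> Dn n X) (cf : continuous f)
    (fs : 'I_n -> X -> X) (hfs : splitting f fs) :
  reidemeister_nvalued p R f = (\sum_(i < n) reidemeister p R (fs i))%E.
Proof.
rewrite /reidemeister_nvalued (lift_factorE p f fs hX hp hfs).
have Lsep i j h h' : lifts p (fs i) h -> lifts p (fs j) h' ->
    deck_conjugate p h h' -> i = j.
  move=> [_ ph] [_ ph'] /deck_conjugate_lifts /(_ ph').
  by have [_ [E0 _ _]] := hp; exact: (lifts_disjoint p f fs i j h E0 hfs).
have [-> tcl] := conjugacy_classes_bigcup p (fun i => lifts p (fs i)) Lsep.
exact: counting_bigcup.
Qed.
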